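(* Let $t\in\mathbb{R}$. If $t<0$, then the bilinear form $\langle\cdot,\cdot\rangle_t$ is continuous and is an inner product on $\mathbb{H}_t$ over $\mathbb{R}$. If $t\geq 0$, then $\langle\cdot,\cdot\rangle_t$ is a continuous indefinite semi-inner product on $\mathbb{H}_t$ over $\mathbb{R}$.
   Context: For $t\in\mathbb{R}$, the $t$-scaled hypercomplex ring $\mathbb{H}_t$ is the set $\mathbb{C}^2$ (with its usual topology) with the usual vector addition and the multiplication $(a_1,b_1)\cdot_t(a_2,b_2)=(a_1a_2+t\,b_1\overline{b_2},\;a_1b_2+b_1\overline{a_2})$; it is regarded as a vector space over $\mathbb{R}$. Set $(a,b)^{\dagger}=(\overline{a},-b)$, $\tau((a,b))=\mathrm{Re}(a)$, and $\langle h_1,h_2\rangle_t=\tau(h_1\cdot_t h_2^{\dagger})\in\mathbb{R}$ for $h_1,h_2\in\mathbb{H}_t$. For a real vector space $X$, a form $\langle\cdot,\cdot\rangle:X\times X\to\mathbb{R}$ is a semi-inner product if it is bilinear over $\mathbb{R}$, symmetric, and $\langle x,x\rangle\geq 0$ for all $x\in X$; it is an inner product if in addition $\langle x,x\rangle=0$ if and only if $x=0$. It is an indefinite semi-inner product if it is bilinear over $\mathbb{R}$, symmetric, and $\langle x,x\rangle\in\mathbb{R}$ for all $x\in X$ (no positivity is required). *)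

(* Defs.v *)
(* The concrete reals of Stdlib, with Coquelicot's complex numbers, modules
   and uniform spaces. *)
From Stdlib Require Import Reals.
From Coquelicot Require Import Coquelicot.

Local Open Scope R_scope.

Definition bilinear_form (X : ModuleSpace R_Ring) (f : X -> X -> R) : Prop :=
  (forall x y z : X, f (plus x y) z = f x z + f y z) /\
  (forall (r : R) (x z : X), f (scal r x) z = r * f x z) /\
  (forall x y z : X, f x (plus y z) = f x y + f x z) /\
  (forall (r : R) (x z : X), f x (scal r z) = r * f x z).

Definition symmetric_form (X : ModuleSpace R_Ring) (f : X -> X -> R) : Prop :=
  forall x y : X, f x y = f y x.

Definition semi_inner_product (X : ModuleSpace R_Ring) (f : X -> X -> R) :
    Prop :=
  bilinear_form X f /\ symmetric_form X f /\ (forall x : X, 0 <= f x x).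

Definition inner_product (X : ModuleSpace R_Ring) (f : X -> X -> R) : Prop :=
  semi_inner_product X f /\ (forall x : X, f x x = 0 <-> x = zero).

(* That f x x is real is part of the type of f. *)
Definition indefinite_semi_inner_product (X : ModuleSpace R_Ring)
    (f : X -> X -> R) : Prop :=
  bilinear_form X f /\ symmetric_form X f.

(* The parameter t does not affect the carrier, the real vector space structure
   or the topology, only the multiplication. *)
Definition H (t : R) : Type := (C * C)%type.

Definition Hmul (t : R) (h1 h2 : H t) : H t :=
  let (a1, b1) := h1 in
  let (a2, b2) := h2 in
  ((a1 * a2 + RtoC t * b1 * Cconj b2)%C, (a1 * b2 + b1 * Cconj a2)%C).

Definition Hone (t : R) : H t := (RtoC 1, RtoC 0).

Definition Hdag (t : R) (h : H t) : H t :=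
  let (a, b) := h in (Cconj a, (- b)%C).

Definition Htau (t : R) (h : H t) : R := Re (fst h).

Definition Hform (t : R) (h1 h2 : H t) : R :=
  Htau t (Hmul t h1 (Hdag t h2)).

(* All structures below are built from the componentwise real one on C * C, so
   that the ring and the real vector space share the same addition. *)
Definition HR (t : R) : ModuleSpace R_Ring :=
  prod_ModuleSpace R_Ring C_R_ModuleSpace C_R_ModuleSpace.

Canonical H_AbelianMonoid (t : R) : AbelianMonoid :=
  AbelianMonoid.Pack (H t) (AbelianMonoid.class (HR t)) (H t).

Canonical H_AbelianGroup (t : R) : AbelianGroup :=
  AbelianGroup.Pack (H t) (AbelianGroup.class (HR t)) (H t).

Canonical H_ModuleSpace (t : R) : ModuleSpace R_Ring :=
  ModuleSpace.Pack R_Ring (H t) (ModuleSpace.class R_Ring (HR t)) (H t).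

Canonical H_UniformSpace (t : R) : UniformSpace :=
  UniformSpace.Pack (H t)
    (UniformSpace.class (prod_UniformSpace C_UniformSpace C_UniformSpace))
    (H t).

Local Ltac H_ring :=
  intros;
  repeat match goal with
         | h : H _ |- _ => destruct h as [[? ?] [? ?]]
         end;
  apply injective_projections; apply injective_projections;
  cbv -[Rplus Rmult Ropp Rminus IZR]; ring.

Lemma Hmul_assoc (t : R) (x y z : H t) :
  Hmul t x (Hmul t y z) = Hmul t (Hmul t x y) z.
Proof. H_ring. Qed.

Lemma Hmul_1_r (t : R) (x : H t) : Hmul t x (Hone t) = x.
Proof. H_ring. Qed.

Lemma Hmul_1_l (t : R) (x : H t) : Hmul t (Hone t) x = x.
Proof. H_ring. Qed.

Lemma Hmul_plus_l (t : R) (x y z : H t) :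
  Hmul t (plus x y) z = plus (Hmul t x z) (Hmul t y z).
Proof. H_ring. Qed.

Lemma Hmul_plus_r (t : R) (x y z : H t) :
  Hmul t x (plus y z) = plus (Hmul t x y) (Hmul t x z).
Proof. H_ring. Qed.

Definition H_Ring_mixin (t : R) : Ring.mixin_of (H_AbelianGroup t) :=
  Ring.Mixin (H_AbelianGroup t) (Hmul t) (Hone t) (Hmul_assoc t) (Hmul_1_r t)
    (Hmul_1_l t) (Hmul_plus_l t) (Hmul_plus_r t).

Canonical H_Ring (t : R) : Ring :=
  Ring.Pack (H t)
    (Ring.Class (H t) (AbelianGroup.class (H_AbelianGroup t)) (H_Ring_mixin t))
    (H t).

(* Joint continuity on H t * H t with the product topology. *)
Definition continuous_form (t : R) (f : H t -> H t -> R) : Prop :=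
  forall p : prod_UniformSpace (H_UniformSpace t) (H_UniformSpace t),
    @continuous (prod_UniformSpace (H_UniformSpace t) (H_UniformSpace t))
      R_UniformSpace (fun q => f (fst q) (snd q)) p.

(* Main.v *)
Require Import Defs.
From Stdlib Require Import Reals Lra.
From Coquelicot Require Import Coquelicot.

Local Open Scope R_scope.

(** Under the identification of [H t] with R^4 the form is diagonal: it equals
    [x1 x2 + y1 y2 - t (u1 u2 + v1 v2)] ([Hform_coord]), because the term
    [t b1 b2^bar] of the product meets the sign that the dagger puts on [b2].
    Bilinearity and symmetry can be read off this formula for every [t]. It is
    a polynomial in the eight real coordinates of the pair of arguments, which
    are projections and hence continuous, so the form is jointly continuous
    for every [t] ([Hform_continuous]). On the diagonal it is
    [x^2 + y^2 + (- t) (u^2 + v^2)]; for [t < 0] this is a combination of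
    squares with positive coefficients, which makes the form positive
    definite. *)

Lemma Hform_coord (t : R) (h k : H t) :
  Hform t h k =
    fst (fst h) * fst (fst k) + snd (fst h) * snd (fst k)
    - t * (fst (snd h) * fst (snd k) + snd (snd h) * snd (snd k)).
Proof.
  destruct h as [[x1 y1] [u1 v1]], k as [[x2 y2] [u2 v2]].
  cbv -[Rplus Rmult Ropp Rminus IZR]; ring.
Qed.

Lemma Hform_bilinear (t : R) : bilinear_form (H_ModuleSpace t) (Hform t).
Proof.
  repeat split; intros; rewrite !Hform_coord;
    repeat match goal with
           | h : ModuleSpace.sort _ _ |- _ => destruct h as [[? ?] [? ?]]
           end;
    cbv -[Rplus Rmult Ropp Rminus IZR]; ring.
Qed.

Lemma Hform_symmetric (t : R) : symmetric_form (H_ModuleSpace t) (Hform t).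
Proof. intros x y; rewrite !Hform_coord; ring. Qed.

Lemma Hform_diag_nonneg (t : R) (h : H t) : t <= 0 -> 0 <= Hform t h h.
Proof. intros Ht; rewrite Hform_coord; nra. Qed.

Lemma Hform_definite (t : R) (h : H t) :
  t < 0 -> (Hform t h h = 0 <-> h = zero).
Proof.
  intros Ht; rewrite Hform_coord.
  destruct h as [[x y] [u v]]; cbn [fst snd]; split.
  - intros E.
    assert (Hx := Rle_0_sqr x); assert (Hy := Rle_0_sqr y);
    assert (Hu := Rle_0_sqr u); assert (Hv := Rle_0_sqr v).
    unfold Rsqr in *.
    assert (Huv : u * u + v * v = 0) by nra.
    assert (x = 0) by (apply Rsqr_0_uniq; unfold Rsqr; nra).
    assert (y = 0) by (apply Rsqr_0_uniq; unfold Rsqr; nra).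
    assert (u = 0) by (apply Rsqr_0_uniq; unfold Rsqr; lra).
    assert (v = 0) by (apply Rsqr_0_uniq; unfold Rsqr; lra).
    subst; reflexivity.
  - intros E; injection E as -> -> -> ->.
    cbv -[Rplus Rmult Ropp Rminus IZR]; ring.
Qed.

Section ContinuityClosure.

Context {U : UniformSpace}.

Lemma continuous_Rplus (f g : U -> R) (x : U) :
  continuous f x -> continuous g x -> continuous (fun q => f q + g q) x.
Proof. exact (continuous_plus (V := R_NormedModule) f g x). Qed.

Lemma continuous_Rminus (f g : U -> R) (x : U) :
  continuous f x -> continuous g x -> continuous (fun q => f q - g q) x.
Proof. exact (continuous_minus (V := R_NormedModule) f g x). Qed.

Lemma continuous_Rmult (f g : U -> R) (x : U) :
  continuous f x -> continuous g x -> continuous (fun q => f q * g q) x.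
Proof. exact (continuous_mult (K := R_AbsRing) f g x). Qed.

Lemma continuous_fst_of {V W : UniformSpace} (f : U -> V * W) (x : U) :
  continuous f x -> continuous (fun q => fst (f q)) x.
Proof.
  intros Hf; apply (continuous_comp f fst); [exact Hf|].
  destruct (f x); apply continuous_fst.
Qed.

Lemma continuous_snd_of {V W : UniformSpace} (f : U -> V * W) (x : U) :
  continuous f x -> continuous (fun q => snd (f q)) x.
Proof.
  intros Hf; apply (continuous_comp f snd); [exact Hf|].
  destruct (f x); apply continuous_snd.
Qed.

End ContinuityClosure.

Lemma Hform_continuous (t : R) : continuous_form t (Hform t).
Proof.
  intros p.
  (* The uniform structure of [H t] is by conversion this iterated product,
     on which the projections to the real coordinates are continuous. *)
  set (C2 := prod_UniformSpace (prod_UniformSpace R_UniformSpace R_UniformSpace)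
               (prod_UniformSpace R_UniformSpace R_UniformSpace)).
  change (@continuous (prod_UniformSpace C2 C2) R_UniformSpace
            (fun q => Hform t (fst q) (snd q)) p).
  apply continuous_ext with (1 := fun q => eq_sym (Hform_coord t (fst q) (snd q))).
  assert (H1 : @continuous (prod_UniformSpace C2 C2) C2 (fun q => fst q) p)
    by apply (continuous_fst_of (fun q => q)), continuous_id.
  assert (H2 : @continuous (prod_UniformSpace C2 C2) C2 (fun q => snd q) p)
    by apply (continuous_snd_of (fun q => q)), continuous_id.
  apply continuous_Rminus;
    [|apply continuous_Rmult; [apply continuous_const|]];
    apply continuous_Rplus; apply continuous_Rmult;
    first [ apply continuous_fst_of | apply continuous_snd_of ];
    first [ apply (continuous_fst_of (V := prod_UniformSpace R_UniformSpace R_UniformSpace))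
          | apply (continuous_snd_of (W := prod_UniformSpace R_UniformSpace R_UniformSpace)) ];
    first [ exact H1 | exact H2 ].
Qed.

Theorem theorem4p10 (t : R) :
  (t < 0 ->
     continuous_form t (Hform t) /\ inner_product (H_ModuleSpace t) (Hform t)) /\
  (0 <= t ->
     continuous_form t (Hform t) /\
     indefinite_semi_inner_product (H_ModuleSpace t) (Hform t)).
Proof.
  split; intros Ht; (split; [apply Hform_continuous|]).
  - split; [split; [apply Hform_bilinear | split; [apply Hform_symmetric|]]|].
    + intros h; apply Hform_diag_nonneg; lra.
    + intros h; apply Hform_definite; exact Ht.
  - split; [apply Hform_bilinear | apply Hform_symmetric].
Qed.
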